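(* Let $p$ be a prime and let $C\leftarrow A\to B$ be a diagram of perfect rings of characteristic $p$. Then $\mathrm{Tor}_i^A(B,C)=0$ for all $i>0$.
   Context: A perfect ring (of characteristic $p$) is a commutative $\mathbf{F}_p$-algebra whose Frobenius $x\mapsto x^p$ is bijective. *)

(* Defs.v *)
From HB Require Import structures.
From mathcomp Require Import all_boot all_algebra.
From mathcomp Require Import finmap.
From mathcomp Require Import boolp classical_sets functions cardinality fsbigop.

Set Implicit Arguments.
Unset Strict Implicit.
Unset Printing Implicit Defensive.

Import GRing.Theory.
Local Open Scope ring_scope.
Local Open Scope quotient_scope.

(* The zero ring is perfect, so rings range over [comPzRingType]; being an
   F_p-algebra is the property that p vanishes in R. *)
Definition perfect (p : nat) (R : comPzRingType) : Prop :=
  p%:R = 0 :> R /\ bijective (fun x : R => x ^+ p).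

Definition restrict_scalars (A B : pzRingType) (f : {rmorphism A -> B}) : Type := B.

Section Restriction.
Variables (A B : pzRingType) (f : {rmorphism A -> B}).

Local Notation fB := (restrict_scalars f).

HB.instance Definition _ := GRing.Zmodule.on fB.

Definition restrict_scale (a : A) (b : fB) : fB :=
  f a * (b : B).

Fact restrict_scaleA a b v :
  restrict_scale a (restrict_scale b v) = restrict_scale (a * b) v.
Proof. by rewrite /restrict_scale rmorphM mulrA. Qed.

Fact restrict_scale1 : left_id 1 restrict_scale.
Proof. by move=> v; rewrite /restrict_scale rmorph1 mul1r. Qed.

Fact restrict_scaleDr : right_distributive restrict_scale +%R.
Proof. by move=> a u v; rewrite /restrict_scale mulrDr. Qed.

Fact restrict_scaleDl v : {morph restrict_scale^~ v : a b / a + b}.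
Proof. by move=> a b; rewrite /restrict_scale rmorphD mulrDl. Qed.

HB.instance Definition _ := GRing.Zmodule_isLmodule.Build A fB
  restrict_scaleA restrict_scale1 restrict_scaleDr restrict_scaleDl.

End Restriction.

Section Submodules.
Variables (A : pzRingType) (V : lmodType A).

Record submodule : Type := Submodule {
  submodule_pred :> {pred V};
  submodule_closed : submod_closed submodule_pred
}.

HB.instance Definition _ (S : submodule) :=
  GRing.isSubmodClosed.Build A V (submodule_pred S) (submodule_closed S).

Record submod (S : submodule) : Type :=
  Submod { submod_val :> V; submod_valP : submod_val \in submodule_pred S }.

HB.instance Definition _ (S : submodule) := [isSub for @submod_val S].
HB.instance Definition _ (S : submodule) := [Choice of submod S by <:].
HB.instance Definition _ (S : submodule) :=
  [SubChoice_isSubLmodule of submod S by <:].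

Fact submod_val_linear (S : submodule) : linear (@submod_val S).
Proof. exact: linearP (\val : {linear submod S -> V}). Qed.

HB.instance Definition _ (S : submodule) := GRing.isLinear.Build A (submod S) V
  *:%R (@submod_val S) (@submod_val_linear S).

Section Quotient.
Variable S : submodule.

Definition quotmod : Type := Quotient.quot (submodule_pred S).

HB.instance Definition _ := GRing.Zmodule.on quotmod.

Definition quotmod_pi (v : V) : quotmod :=
  \pi_(Quotient.quot (submodule_pred S)) v.

Fact quotmod_eqP (u v : V) :
  quotmod_pi u = quotmod_pi v <-> u - v \in submodule_pred S.
Proof. by rewrite Quotient.idealrBE; split=> [/eqP|/eqP]. Qed.

Fact quotmod_repr (x : quotmod) : {v | x = quotmod_pi v}.
Proof.
by exists (repr (x : Quotient.quot (submodule_pred S))); rewrite /quotmod_pi reprK.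
Qed.

Fact quotmod_pi_additive : {morph quotmod_pi : u v / u - v}.
Proof. exact: raddfB. Qed.

HB.instance Definition _ :=
  GRing.isZmodMorphism.Build V quotmod quotmod_pi quotmod_pi_additive.

Definition quotmod_scale (a : A) (x : quotmod) : quotmod :=
  quotmod_pi (a *: repr (x : Quotient.quot (submodule_pred S))).

Fact quotmod_pi_scale a v : quotmod_scale a (quotmod_pi v) = quotmod_pi (a *: v).
Proof.
apply/quotmod_eqP; rewrite -scalerBr rpredZ //.
by apply/quotmod_eqP; rewrite /quotmod_pi reprK.
Qed.

Fact quotmod_scaleA a b v :
  quotmod_scale a (quotmod_scale b v) = quotmod_scale (a * b) v.
Proof.
by have [u ->] := quotmod_repr v; rewrite !quotmod_pi_scale scalerA.
Qed.

Fact quotmod_scale1 : left_id 1 quotmod_scale.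
Proof. by move=> v; have [u ->] := quotmod_repr v; rewrite quotmod_pi_scale scale1r. Qed.

Fact quotmod_scaleDr : right_distributive quotmod_scale +%R.
Proof.
move=> a v w; have [u ->] := quotmod_repr v; have [t ->] := quotmod_repr w.
by rewrite -raddfD !quotmod_pi_scale scalerDr raddfD.
Qed.

Fact quotmod_scaleDl v : {morph quotmod_scale^~ v : a b / a + b}.
Proof.
move=> a b; have [u ->] := quotmod_repr v.
by rewrite !quotmod_pi_scale scalerDl raddfD.
Qed.

HB.instance Definition _ := GRing.Zmodule_isLmodule.Build A quotmod
  quotmod_scaleA quotmod_scale1 quotmod_scaleDr quotmod_scaleDl.

Fact quotmod_pi_scalable : scalable quotmod_pi.
Proof. by move=> a v; rewrite -quotmod_pi_scale. Qed.

HB.instance Definition _ :=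
  GRing.isScalable.Build A V quotmod *:%R quotmod_pi quotmod_pi_scalable.

End Quotient.

Definition spanned (G : set V) : {pred V} :=
  [pred v | `[< forall S : submodule, {in G, forall w, w \in submodule_pred S} ->
                 v \in submodule_pred S >]].

Fact spanned_closed (G : set V) : submod_closed (spanned G).
Proof.
split=> [|a u v]; first by apply/asboolP => S _; exact: rpred0.
move=> /asboolP uS /asboolP vS; apply/asboolP => S GS.
by rewrite rpredD ?rpredZ ?uS ?vS.
Qed.

Definition span (G : set V) : submodule := Submodule (spanned_closed G).

End Submodules.

Section KerIm.
Variables (A : pzRingType) (U V : lmodType A) (f : {linear U -> V}).

Fact ker_closed : submod_closed [pred u | f u == 0].
Proof.
split=> [|a u v]; rewrite !inE ?raddf0 //.
by move=> /eqP fu /eqP fv; rewrite linearP fu fv scaler0 addr0.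
Qed.

Definition ker : submodule U := Submodule ker_closed.

Fact im_closed : submod_closed [pred v | `[< exists u, f u = v >]].
Proof.
split=> [|a u v]; first by apply/asboolP; exists 0; rewrite raddf0.
move=> /asboolP[u' <-] /asboolP[v' <-]; apply/asboolP.
by exists (a *: u' + v'); rewrite linearP.
Qed.

Definition im : submodule V := Submodule im_closed.

Fact preim_closed (S : submodule V) :
  submod_closed [pred u | f u \in submodule_pred S].
Proof.
split=> [|a u v]; rewrite !inE ?raddf0 ?rpred0 //.
by move=> fu fv; rewrite linearP rpredD ?rpredZ.
Qed.

Definition preim_submod (S : submodule V) : submodule U :=
  Submodule (preim_closed S).

End KerIm.

Section QuotLift.
Variables (A : pzRingType) (U V : lmodType A) (S : submodule U).
Variables (f : {linear U -> V}) (fS : forall u, u \in submodule_pred S -> f u = 0).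

Definition quot_lift of (forall u, u \in submodule_pred S -> f u = 0) :=
  fun x : quotmod S => f (projT1 (quotmod_repr x)).

Fact quot_liftE u : quot_lift fS (quotmod_pi S u) = f u.
Proof.
rewrite /quot_lift; case: quotmod_repr => v /= /quotmod_eqP uv.
by apply/esym/eqP; rewrite -subr_eq0 -linearB; apply/eqP/fS.
Qed.

Fact quot_lift_linear : linear (quot_lift fS).
Proof.
move=> a x y; have [u ->] := quotmod_repr x; have [v ->] := quotmod_repr y.
by rewrite -linearP !quot_liftE linearP.
Qed.

HB.instance Definition _ :=
  GRing.isLinear.Build A (quotmod S) V *:%R (quot_lift fS) quot_lift_linear.

End QuotLift.

Section Free.
Variables (A : pzRingType) (S : choiceType).

Definition fin_supported : {pred S -> A^o} :=
  [pred c : S -> A^o | `[< finite_set [set s | c s != 0] >]].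

Fact fin_supported_closed : submod_closed fin_supported.
Proof.
split=> [|a c d].
  by apply/asboolP; apply: (sub_finite_set _ (finite_set0 S)) => s /=; rewrite eqxx.
move=> /asboolP fc /asboolP fd; apply/asboolP.
have fcd : finite_set ([set s | c s != 0] `|` [set s | d s != 0])%classic.
  by rewrite finite_setU.
apply: (sub_finite_set _ fcd) => s /=; case: (eqVneq (c s) 0) => [cs0|]; last by left.
case: (eqVneq (d s) 0) => [ds0|]; last by right.
rewrite (_ : (a *: c + d) s = a *: c s + d s) // cs0 ds0.
by rewrite scaler0 addr0 eqxx.
Qed.

Definition freemod : lmodType A := submod (Submodule fin_supported_closed).

Definition free_coef (x : freemod) (s : S) : A := (submod_val x : S -> A^o) s.

Fact delta_fin (s : S) : (fun t => (t == s)%:R : A^o) \in fin_supported.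
Proof.
apply/asboolP; apply: (sub_finite_set _ (finite_set1 s)) => t /=.
by case: (t =P s) => //= _; rewrite eqxx.
Qed.

Definition free_gen (s : S) : freemod :=
  @Submod _ _ (Submodule fin_supported_closed) _ (delta_fin s).

Variables (V : lmodType A) (h : S -> V).

Definition free_lift (x : freemod) : V :=
  \sum_(s \in [set: S]) free_coef x s *: h s.

Fact free_coef_finite (x : freemod) : finite_set [set s | free_coef x s != 0].
Proof. by case: x => c /= /asboolP. Qed.

Fact free_liftE (x : freemod) (X : {fset S}) :
  (forall s, free_coef x s != 0 -> s \in X) ->
  free_lift x = \sum_(s <- X) free_coef x s *: h s.
Proof.
move=> sX; apply: fsbigTE => s; apply: contraNeq => xs; apply: sX.
by apply: contra_neq xs => ->; rewrite scale0r.
Qed.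

Fact free_lift_linear : linear free_lift.
Proof.
move=> a x y.
pose X := (fset_set [set s | free_coef x s != 0] `|`
           fset_set [set s | free_coef y s != 0])%fset.
have sx s : free_coef x s != 0 -> s \in X.
  by move=> ?; rewrite in_fsetU in_fset_set ?mem_set //; exact: free_coef_finite.
have sy s : free_coef y s != 0 -> s \in X.
  move=> ?; rewrite in_fsetU orbC in_fset_set ?mem_set //.
  exact: free_coef_finite.
have cE s : free_coef (a *: x + y) s = a * free_coef x s + free_coef y s by [].
have sxy s : free_coef (a *: x + y) s != 0 -> s \in X.
  rewrite cE; apply: contraR => sX.
  by rewrite (eqP (contraR (@sx s) sX)) (eqP (contraR (@sy s) sX)) mulr0 addr0.
rewrite (free_liftE sxy) (free_liftE sx) (free_liftE sy).
rewrite scaler_sumr -big_split; apply: eq_bigr => s _.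
by rewrite cE scalerDl -scalerA.
Qed.

HB.instance Definition _ :=
  GRing.isLinear.Build A freemod V *:%R free_lift free_lift_linear.

Fact free_lift_gen s : free_lift (free_gen s) = h s.
Proof.
rewrite (@free_liftE _ [fset s]%fset) ?big_seq_fset1 => [|t].
  by rewrite /free_coef /= eqxx scale1r.
by rewrite /free_coef /= inE; case: (t =P s) => //= _; rewrite eqxx.
Qed.

End Free.


Section FreeTheory.
Variables (A : pzRingType) (S : choiceType).

Fact free_gen_span (x : freemod A S) : free_lift (@free_gen A S) x = x.
Proof.
have sx s : free_coef x s != 0 -> s \in fset_set [set s | free_coef x s != 0].
  by move=> ?; rewrite in_fset_set ?mem_set //; exact: free_coef_finite.
apply: val_inj; apply/funext => t; rewrite (free_liftE _ sx) raddf_sum /=.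
rewrite fct_sumE; set X := fset_set _ in sx *.
transitivity (\sum_(s <- X) free_coef x s * (t == s)%:R); first by [].
rewrite -[RHS]/(free_coef x t); have [tX|tX] := boolP (t \in X).
  rewrite (big_fsetD1 t) //= eqxx mulr1 big_seq big1 ?addr0 // => s.
  by rewrite !inE eq_sym => /andP[/negPf -> _]; rewrite mulr0.
rewrite (eqP (contraR (@sx t) tX)) big_seq big1 // => s sX.
by rewrite (_ : t == s = false) ?mulr0 //; apply: contraNF tX => /eqP ->.
Qed.

Fact free_ext (V : lmodType A) (f g : {linear freemod A S -> V}) :
  (forall s, f (free_gen A s) = g (free_gen A s)) -> f =1 g.
Proof.
move=> fg x; rewrite -[x]free_gen_span.
have [X ->] : exists X : {fset S}, free_lift (@free_gen A S) x =
    \sum_(s <- X) free_coef x s *: free_gen A s.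
  exists (fset_set [set s | free_coef x s != 0]); apply: free_liftE => s ?.
  by rewrite in_fset_set ?mem_set //; exact: free_coef_finite.
by rewrite !linear_sum; apply: eq_bigr => s _; rewrite !linearZ fg.
Qed.

End FreeTheory.

Section Tensor.
Variable A : comPzRingType.

Inductive bilinear_relation (M N : lmodType A) : set (freemod A (M * N)%type) :=
| BilinearDl m m' n : bilinear_relation
    (free_gen A (m + m', n) - (free_gen A (m, n) + free_gen A (m', n)))
| BilinearDr m n n' : bilinear_relation
    (free_gen A (m, n + n') - (free_gen A (m, n) + free_gen A (m, n')))
| BilinearZl a m n : bilinear_relation
    (free_gen A (a *: m, n) - a *: free_gen A (m, n))
| BilinearZr a m n : bilinear_relation
    (free_gen A (m, a *: n) - a *: free_gen A (m, n)).

Definition tensor (M N : lmodType A) : lmodType A :=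
  quotmod (span (@bilinear_relation M N)).

Definition pure_tensor (M N : lmodType A) (m : M) (n : N) : tensor M N :=
  quotmod_pi _ (free_gen A (m, n)).


Fact quotmod_pi_span0 (V : lmodType A) (G : set V) (u v : V) :
  G (u - v) -> quotmod_pi (span G) u = quotmod_pi (span G) v.
Proof.
move=> Guv; apply/quotmod_eqP/asboolP => S; apply.
exact: mem_set.
Qed.

Section TensorTheory.
Variables (M N : lmodType A).

Fact pure_tensorDl (m m' : M) (n : N) :
  pure_tensor (m + m') n = pure_tensor m n + pure_tensor m' n.
Proof. by rewrite /pure_tensor -raddfD; exact/quotmod_pi_span0/BilinearDl. Qed.

Fact pure_tensorDr (m : M) (n n' : N) :
  pure_tensor m (n + n') = pure_tensor m n + pure_tensor m n'.
Proof. by rewrite /pure_tensor -raddfD; exact/quotmod_pi_span0/BilinearDr. Qed.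

Fact pure_tensorZl a (m : M) (n : N) :
  pure_tensor (a *: m) n = a *: pure_tensor m n.
Proof. by rewrite /pure_tensor -linearZ; exact/quotmod_pi_span0/BilinearZl. Qed.

Fact pure_tensorZr a (m : M) (n : N) :
  pure_tensor m (a *: n) = a *: pure_tensor m n.
Proof. by rewrite /pure_tensor -linearZ; exact/quotmod_pi_span0/BilinearZr. Qed.

Fact tensor_ext (V : lmodType A) (f g : {linear tensor M N -> V}) :
  (forall m n, f (pure_tensor m n) = g (pure_tensor m n)) -> f =1 g.
Proof.
move=> fg x; have [v ->] := quotmod_repr x.
pose q := quotmod_pi (span (@bilinear_relation M N)).
by apply: (@free_ext _ _ _ (f \o q) (g \o q)) => -[m n]; exact: fg.
Qed.

End TensorTheory.

Section TensorMap.
Variables (M M' N : lmodType A) (h : {linear M -> M'}).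

Definition tensor_map_gen (mn : M * N) : tensor M' N :=
  pure_tensor (h mn.1) mn.2.

Fact tensor_map_subproof (u : freemod A (M * N)%type) :
  u \in submodule_pred (span (@bilinear_relation M N)) ->
  free_lift tensor_map_gen u = 0.
Proof.
move=> /asboolP/(_ (ker (free_lift tensor_map_gen))) uS; apply/eqP/uS => {uS} w.
rewrite inE => -[m m' n|m n n'|a m n|a m n]; apply/eqP.
- by rewrite linearB linearD /= !free_lift_gen /tensor_map_gen /= linearD pure_tensorDl subrr.
- by rewrite linearB linearD /= !free_lift_gen /tensor_map_gen /= pure_tensorDr subrr.
- by rewrite linearB linearZ /= !free_lift_gen /tensor_map_gen /= linearZ pure_tensorZl subrr.
- by rewrite linearB linearZ /= !free_lift_gen /tensor_map_gen /= pure_tensorZr subrr.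
Qed.

Definition tensor_map : {linear tensor M N -> tensor M' N} :=
  quot_lift tensor_map_subproof.

Fact tensor_mapE m n : tensor_map (pure_tensor m n) = pure_tensor (h m) n.
Proof. exact: etrans (quot_liftE _ _) (free_lift_gen _ _). Qed.

End TensorMap.

End Tensor.

Section Homology.
Variable A : pzRingType.

Record chain_complex : Type := ChainComplex {
  chain :> nat -> lmodType A;
  diff : forall n, {linear chain n.+1 -> chain n};
  diffK : forall n (x : chain n.+2), diff n (diff n.+1 x) = 0
}.

Variable C : chain_complex.

Definition diff_out (n : nat) : {linear C n -> C n.-1} :=
  match n return {linear C n -> C n.-1} with
  | 0 => \0
  | n'.+1 => diff C n'
  end.

Definition cycles (n : nat) : lmodType A := submod (ker (diff_out n)).

Definition boundaries (n : nat) : submodule (cycles n) :=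
  preim_submod (@submod_val _ _ (ker (diff_out n))) (im (diff C n)).

Definition homology (n : nat) : lmodType A := quotmod (boundaries n).

End Homology.

Section Resolution.
Variable A : pzRingType.

Definition projective (P : lmodType A) : Prop :=
  forall (X Y : lmodType A) (q : {linear X -> Y}) (h : {linear P -> Y}),
    (forall y, exists x, q x = y) ->
    exists k : {linear P -> X}, forall v, q (k v) = h v.

Fact freemod_projective (S : choiceType) : projective (freemod A S).
Proof.
move=> X Y q h /choice[r qr].
exists (free_lift (fun s => r (h (free_gen A s)))).
by apply: (@free_ext _ _ _ (q \o _)) => s /=; rewrite free_lift_gen qr.
Qed.

Record projective_resolution (M : lmodType A) : Type := ProjectiveResolution {
  res_complex :> chain_complex A;
  res_aug : {linear res_complex 0%N -> M};
  res_projective : forall n, projective (res_complex n);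
  res_aug_surj : forall m, exists x, res_aug x = m;
  res_exact0 : forall x, res_aug x = 0 <-> exists y, diff res_complex 0 y = x;
  res_exactS : forall n x,
    diff res_complex n x = 0 <-> exists y, diff res_complex n.+1 y = x
}.

Section FreeResolution.
Variable M : lmodType A.

Definition free_cover (V : lmodType A) : {linear freemod A V -> V} :=
  free_lift (id : V -> V).

Fixpoint syzygy (n : nat) : lmodType A :=
  if n is n'.+1 then submod (ker (free_cover (syzygy n'))) else M.

Definition free_diff (n : nat) :
    {linear freemod A (syzygy n.+1) -> freemod A (syzygy n)} :=
  @submod_val _ _ (ker (free_cover (syzygy n))) \o free_cover (syzygy n.+1).

Fact free_cover_surj (V : lmodType A) (v : V) : exists x, free_cover V x = v.
Proof. by exists (free_gen A v); exact: free_lift_gen. Qed.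

Fact free_diff_im n x :
  free_cover (syzygy n) x = 0 <-> exists y, free_diff n y = x.
Proof.
split=> [x0|[y <-]]; last by apply/eqP; exact: submod_valP (free_cover _ y).
have kx : x \in submodule_pred (ker (free_cover (syzygy n))) by apply/eqP.
by have [y yx] := free_cover_surj (Submod kx); exists y; rewrite /= yx.
Qed.

Fact free_diff_exact n x : free_diff n x = 0 <-> exists y, free_diff n.+1 y = x.
Proof.
rewrite -free_diff_im; split=> [x0|/= ->]; last by rewrite raddf0.
exact: val_inj.
Qed.

Fact free_diffK n (x : freemod A (syzygy n.+2)) :
  free_diff n (free_diff n.+1 x) = 0.
Proof. by apply/free_diff_exact; exists x. Qed.

Definition free_complex : chain_complex A :=
  @ChainComplex A (fun n => freemod A (syzygy n)) free_diff free_diffK.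

Definition free_resolution : projective_resolution M :=
  @ProjectiveResolution M free_complex (free_cover M)
    (fun n => @freemod_projective (syzygy n)) (@free_cover_surj M)
    (@free_diff_im 0) free_diff_exact.

End FreeResolution.
End Resolution.

Section Tor.
Variables (A : comPzRingType) (M N : lmodType A).

Section TensorComplex.
Variable C : chain_complex A.

Fact tensor_diffK n (x : tensor (C n.+2) N) :
  tensor_map N (diff C n) (tensor_map N (diff C n.+1) x) = 0.
Proof.
apply: (@tensor_ext _ _ _ _ (tensor_map N (diff C n) \o tensor_map N (diff C n.+1))
  \0) => m v.
apply: (etrans (congr1 (tensor_map N (diff C n)) (tensor_mapE _ _ _))).
by rewrite tensor_mapE diffK -(scale0r 0) pure_tensorZl scale0r.
Qed.

Definition tensor_complex : chain_complex A :=
  ChainComplex tensor_diffK.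

End TensorComplex.

(* Any projective resolution of M computes the same modules up to isomorphism;
   as usual Tor is defined by choosing one, here the free resolution whose terms
   are free on the underlying sets of the successive syzygies. *)
Definition Tor (i : nat) : lmodType A :=
  homology (tensor_complex (free_resolution M)) i.

End Tor.

(* Main.v *)
Require Import Defs.
From HB Require Import structures.
From mathcomp Require Import all_boot all_algebra.
From mathcomp Require Import boolp classical_sets cardinality.

Set Implicit Arguments.
Unset Strict Implicit.
Unset Printing Implicit Defensive.

Import GRing.Theory.
Local Open Scope ring_scope.

(** Write A[V] for the free A-module on the underlying set of a module V.  When V
carries an associative and commutative A-bilinear product (a non-unital
commutative A-algebra), A[V] is the semigroup algebra of the multiplicative
semigroup V, the canonical cover A[V] -> V is multiplicative, and its kernel is
an ideal.  If A and V are perfect then so are A[V] and this kernel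
([semigroup_algebra_perfect], [kernel_algebra_perfect]).  Starting from V = B,
every syzygy of the free resolution whose i-th homology defines Tor is therefore
a perfect non-unital A-algebra ([syzygy_perfect]).

It remains to see that for K the kernel of A[V] -> V the map
K (x) C -> A[V] (x) C is injective ([tensor_kernel_inj]); the vanishing then
follows from the right exactness of the tensor product.  Since K is an ideal of
A[V], the algebra A[V] (x) C acts on K (x) C, and the product xy of two elements of
K (x) C is the action on y of the image of x in A[V] (x) C.  If that image is 0
then x^2 = 0, so x^p = 0.  But K (x) C is the tensor product of two perfect
algebras, so its Frobenius has an inverse, k (x) c |-> k^(1/p) (x) c^(1/p)
([tensor_frob_inj]).  Hence x = 0. *)

(** * Preliminaries on free modules and bilinear maps *)

Lemma expr_primeD (p : nat) (R : comPzRingType) (x y : R) :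
  prime p -> p%:R = 0 :> R -> (x + y) ^+ p = x ^+ p + y ^+ p.
Proof.
move=> p_prime p0; have defp := prednK (prime_gt0 p_prime).
rewrite exprDn big_ord_recr subnn -defp big_ord_recl /= defp.
rewrite subn0 mulr1 mul1r bin0 binn big1 ?addr0 // => i _.
rewrite -mulr_natl; have /dvdnP[k ->] : (p %| 'C(p, bump 0 i))%N.
  by rewrite prime_dvd_bin //= -{2}defp ltnS ltn_ord.
by rewrite natrM p0 mulr0 mul0r.
Qed.

Lemma freemod_ind (A : pzRingType) (S : choiceType) (P : freemod A S -> Prop) :
  P 0 -> (forall x y, P x -> P y -> P (x + y)) ->
  (forall a s, P (a *: free_gen A s)) -> forall x, P x.
Proof.
move=> P0 PD Pg x; rewrite -[x]free_gen_span.
rewrite (@free_liftE _ _ _ _ x (fset_set [set s | free_coef x s != 0])).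
  by elim/big_ind: _.
by move=> s xs; rewrite in_fset_set ?mem_set //; exact: free_coef_finite.
Qed.

Definition bilinear_op (A : pzRingType) (U V W : lmodType A)
    (op : U -> V -> W) : Prop :=
  (forall v, linear (op^~ v)) /\ (forall u, linear (op u)).

Section BilinearTheory.
Variables (A : pzRingType) (U V W : lmodType A) (op : U -> V -> W).
Hypothesis op_bilin : bilinear_op op.

Lemma bilin_Pl a u u' v : op (a *: u + u') v = a *: op u v + op u' v.
Proof. exact: op_bilin.1. Qed.

Lemma bilin_Pr a u v v' : op u (a *: v + v') = a *: op u v + op u v'.
Proof. exact: op_bilin.2. Qed.

Lemma bilin_Dl u u' v : op (u + u') v = op u v + op u' v.
Proof. by rewrite -[u]scale1r bilin_Pl !scale1r. Qed.

Lemma bilin_Dr u v v' : op u (v + v') = op u v + op u v'.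
Proof. by rewrite -[v]scale1r bilin_Pr !scale1r. Qed.

Lemma bilin_0l v : op 0 v = 0.
Proof. by apply: (addrI (op 0 v)); rewrite -bilin_Dl !addr0. Qed.

Lemma bilin_0r u : op u 0 = 0.
Proof. by apply: (addrI (op u 0)); rewrite -bilin_Dr !addr0. Qed.

Lemma bilin_Zl a u v : op (a *: u) v = a *: op u v.
Proof. by rewrite -[a *: u]addr0 bilin_Pl bilin_0l addr0. Qed.

Lemma bilin_Zr a u v : op u (a *: v) = a *: op u v.
Proof. by rewrite -[a *: v]addr0 bilin_Pr bilin_0r addr0. Qed.

End BilinearTheory.

(** * Non-unital commutative algebras and their Frobenius *)

Section PerfectAlgebras.
Variable A : comPzRingType.

Record algebra_mul (V : lmodType A) : Type := AlgebraMul {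
  amul :> V -> V -> V;
  amul_bilin : bilinear_op amul;
  amulC : commutative amul;
  amulA : associative amul
}.

(** The p-th power of x: without a unit, powers are built up from x itself by p - 1
further multiplications. *)
Definition frob (p : nat) (V : lmodType A) (m : V -> V -> V) (x : V) : V :=
  iter p.-1 (m x) x.

(** Adjoining a unit embeds a non-unital algebra in a ring, from which the additivity
of the p-th power is inherited. *)
Section Unitalization.
Variables (V : lmodType A) (m : algebra_mul V).

Definition unitalization of algebra_mul V : Type := (A * V)%type.
Local Notation U := (unitalization m).

HB.instance Definition _ := GRing.Zmodule.on U.

Definition unit_mul (x y : U) : U :=
  (x.1 * y.1, x.1 *: y.2 + y.1 *: x.2 + m x.2 y.2).

Let bil := amul_bilin m.

Fact unit_mulC : commutative unit_mul.
Proof.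
move=> [a v] [b w]; rewrite /unit_mul /= [a * b]mulrC amulC.
by rewrite [a *: w + _]addrC.
Qed.

Fact unit_mulA : associative unit_mul.
Proof.
move=> [a u] [b v] [c w]; rewrite /unit_mul /=; congr pair; first exact: mulrA.
rewrite !(bilin_Dl bil, bilin_Dr bil, bilin_Zl bil, bilin_Zr bil) !scalerDr.
rewrite !scalerA amulA [c * a]mulrC [c * b]mulrC.
by rewrite [LHS](AC (4*3) ((1*(2*4*6))*(3*5*7))).
Qed.

Fact unit_mul1 : left_id ((1, 0) : U) unit_mul.
Proof.
by move=> [a v]; rewrite /unit_mul /= mul1r scale1r scaler0 (bilin_0l bil) !addr0.
Qed.

Fact unit_mulDl : left_distributive unit_mul +%R.
Proof.
move=> [a u] [b v] [c w]; rewrite /unit_mul; congr pair; first exact: mulrDl.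
rewrite /= (bilin_Dl bil) scalerDr scalerDl.
by rewrite [LHS](AC (2*2*2) ((1*3*5)*(2*4*6))).
Qed.

HB.instance Definition _ := GRing.Zmodule_isComPzRing.Build U
  unit_mulA unit_mulC unit_mul1 unit_mulDl.

Definition unit_inj (v : V) : U := (0, v).

Lemma unit_injM v w : unit_inj (m v w) = unit_inj v * unit_inj w.
Proof. by congr pair; rewrite ?mul0r //= !scale0r !add0r. Qed.

Lemma unit_injD v w : unit_inj (v + w) = unit_inj v + unit_inj w.
Proof. by congr pair; rewrite ?addr0. Qed.

Lemma unit_inj_inj : injective unit_inj.
Proof. by move=> v w []. Qed.

Lemma unit_natr n : n%:R = (n%:R, 0) :> U.
Proof. by elim: n => // n IHn; rewrite !mulrS IHn; congr pair; rewrite addr0. Qed.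

Lemma unit_inj_frob p v : prime p -> unit_inj (frob p m v) = unit_inj v ^+ p.
Proof.
rewrite /frob; case: p => // p _ /=; elim: p => [|p IHp] /=; first by rewrite expr1.
by rewrite unit_injM IHp -exprS.
Qed.

End Unitalization.

Section FrobeniusTheory.
Variables (p : nat) (V : lmodType A) (m : algebra_mul V).
Hypotheses (p_prime : prime p) (A_p : p%:R = 0 :> A).

Lemma frobD x y : frob p m (x + y) = frob p m x + frob p m y.
Proof.
apply: (@unit_inj_inj _ m); rewrite unit_injD !unit_inj_frob // unit_injD.
by apply: expr_primeD => //; rewrite unit_natr A_p.
Qed.

Lemma iter_amul_scale n a x :
  iter n (m (a *: x)) (a *: x) = a ^+ n.+1 *: iter n (m x) x.
Proof.
elim: n => [|n IHn] /=; first by rewrite expr1.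
by rewrite IHn (bilin_Zl (amul_bilin m)) (bilin_Zr (amul_bilin m)) scalerA -exprS.
Qed.

Lemma frobZ a x : frob p m (a *: x) = a ^+ p *: frob p m x.
Proof. by rewrite /frob iter_amul_scale prednK // prime_gt0. Qed.

Lemma frob0 : frob p m 0 = 0.
Proof. by apply: (addrI (frob p m 0)); rewrite -frobD !addr0. Qed.

Lemma frob_inj : (forall x, frob p m x = 0 -> x = 0) -> injective (frob p m).
Proof.
move=> ker0 x y xy; apply/eqP; rewrite -subr_eq0; apply/eqP/ker0.
by apply: (addIr (frob p m y)); rewrite -frobD subrK add0r.
Qed.

Lemma frob_sqr0 x : m x x = 0 -> frob p m x = 0.
Proof.
move=> xx; rewrite /frob; case: p p_prime => [|[|n]] //= _.
by elim: n => [|n IHn] //=; rewrite IHn (bilin_0r (amul_bilin m)).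
Qed.

End FrobeniusTheory.

Definition perfect_algebra (p : nat) (V : lmodType A) (m : algebra_mul V) : Prop :=
  bijective (frob p m).

(** * Semigroup algebras and the kernel of the canonical cover *)

Section SemigroupAlgebra.
Variables (V : lmodType A) (m : algebra_mul V).

Definition free_mul (x y : freemod A V) : freemod A V :=
  free_lift (fun s => free_lift (fun t => free_gen A (m s t)) y) x.

Lemma free_mul_gen s t :
  free_mul (free_gen A s) (free_gen A t) = free_gen A (m s t).
Proof. by rewrite /free_mul !free_lift_gen. Qed.

Fact free_mul_bilin : bilinear_op free_mul.
Proof.
split=> [y|x] a u v; first by rewrite /free_mul linearP.
rewrite /free_mul; elim/freemod_ind: x => [|x y IHx IHy|b s].
- by rewrite !raddf0 addr0.
- by rewrite !raddfD /= IHx IHy addrACA.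
- by rewrite !linearZ /= !free_lift_gen linearP scalerDr !scalerA mulrC.
Qed.

Fact free_mulC : commutative free_mul.
Proof.
have bil := free_mul_bilin; move=> x y.
elim/freemod_ind: x => [|x x' IHx IHx'|a s].
- by rewrite (bilin_0l bil) (bilin_0r bil).
- by rewrite (bilin_Dl bil) (bilin_Dr bil) IHx IHx'.
rewrite (bilin_Zl bil) (bilin_Zr bil); congr (_ *: _).
elim/freemod_ind: y => [|y y' IHy IHy'|b t].
- by rewrite (bilin_0l bil) (bilin_0r bil).
- by rewrite (bilin_Dl bil) (bilin_Dr bil) IHy IHy'.
by rewrite (bilin_Zl bil) (bilin_Zr bil) !free_mul_gen amulC.
Qed.

Fact free_mulA : associative free_mul.
Proof.
have bil := free_mul_bilin; move=> x y z.
elim/freemod_ind: x => [|x x' IHx IHx'|a s].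
- by rewrite !(bilin_0l bil).
- by rewrite !(bilin_Dl bil) IHx IHx'.
rewrite !(bilin_Zl bil); congr (_ *: _).
elim/freemod_ind: y => [|y y' IHy IHy'|b t].
- by rewrite (bilin_0r bil) !(bilin_0l bil) (bilin_0r bil).
- by rewrite (bilin_Dr bil) !(bilin_Dl bil) (bilin_Dr bil) IHy IHy'.
rewrite (bilin_Zr bil) !(bilin_Zl bil) (bilin_Zr bil); congr (_ *: _).
elim/freemod_ind: z => [|z z' IHz IHz'|c u].
- by rewrite !(bilin_0r bil).
- by rewrite !(bilin_Dr bil) IHz IHz'.
by rewrite !(bilin_Zr bil) !free_mul_gen amulA.
Qed.

Definition semigroup_algebra : algebra_mul (freemod A V) :=
  AlgebraMul free_mul_bilin free_mulC free_mulA.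

Lemma free_cover_mul x y :
  free_cover V (free_mul x y) = m (free_cover V x) (free_cover V y).
Proof.
have [bil bim] := (free_mul_bilin, amul_bilin m).
elim/freemod_ind: x => [|x x' IHx IHx'|a s].
- by rewrite (bilin_0l bil) !raddf0 (bilin_0l bim).
- by rewrite (bilin_Dl bil) !raddfD /= (bilin_Dl bim) IHx IHx'.
rewrite (bilin_Zl bil) !linearZ /= (bilin_Zl bim); congr (_ *: _).
elim/freemod_ind: y => [|y y' IHy IHy'|b t].
- by rewrite (bilin_0r bil) !raddf0 (bilin_0r bim).
- by rewrite (bilin_Dr bil) !raddfD /= (bilin_Dr bim) IHy IHy'.
rewrite (bilin_Zr bil) !linearZ /= (bilin_Zr bim) free_mul_gen.
by rewrite /free_cover !free_lift_gen.
Qed.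

Lemma frob_gen p s :
  frob p free_mul (free_gen A s) = free_gen A (frob p m s).
Proof.
by rewrite /frob; elim: p.-1 => //= n ->; rewrite free_mul_gen.
Qed.

Section Perfect.
Variable p : nat.
Hypotheses (p_prime : prime p) (perfA : perfect p A).
Hypothesis perfV : perfect_algebra p m.

(** Both sides are additive in x, so monomials a[t] suffice; there it holds because
s^p = t^p forces s = t.  Injectivity of the Frobenius of A[V] can be read off. *)
Lemma free_coef_frob x s :
  free_coef (frob p free_mul x) (frob p m s) = free_coef x s ^+ p.
Proof.
have [A_p _] := perfA.
have frobFD := frobD semigroup_algebra p_prime A_p.
have frobFZ := frobZ semigroup_algebra p_prime.
elim/freemod_ind: x => [|x y IHx IHy|a t].
- rewrite (frob0 semigroup_algebra p_prime A_p) /free_coef /=.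
  by rewrite expr0n eqn0Ngt prime_gt0.
- have coefD u v r : free_coef (u + v) r = free_coef u r + free_coef v r by [].
  by rewrite frobFD !coefD IHx IHy expr_primeD.
rewrite frobFZ frob_gen; transitivity (a ^+ p * (frob p m s == frob p m t)%:R) => //.
rewrite (inj_eq (bij_inj perfV)); transitivity ((a * (s == t)%:R) ^+ p) => //.
by rewrite exprMn; case: eqP; rewrite ?expr1n // expr0n eqn0Ngt prime_gt0.
Qed.

(** The image of Frobenius is closed under addition and contains every monomial
a[s], being the p-th power of a^(1/p)[s^(1/p)]. *)
Lemma semigroup_algebra_perfect : perfect_algebra p semigroup_algebra.
Proof.
have [A_p [root rootK Kroot]] := perfA; have [r rK Kr] := perfV.
have injA : injective (fun a : A => a ^+ p) := can_inj rootK.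
have inj_frob : injective (frob p semigroup_algebra).
  apply: (frob_inj p_prime A_p) => x x0; apply: val_inj; apply/funext => s.
  apply: injA; rewrite -[LHS]free_coef_frob x0.
  by rewrite [RHS]expr0n eqn0Ngt prime_gt0.
have /choice[root_free rootP] : forall x, exists y, frob p semigroup_algebra y = x.
  elim/freemod_ind => [|_ _ [x <-] [y <-]|a s].
  - by exists 0; exact: frob0.
  - by exists (x + y); exact: frobD.
  exists (root a *: free_gen A (r s)).
  by rewrite frobZ // frob_gen [root a ^+ p]Kroot Kr.
by exists root_free => // x; apply: inj_frob; rewrite rootP.
Qed.

End Perfect.

Section KernelIdeal.

Let K : lmodType A := submod (ker (free_cover V)).

Fact ideal_mem (x : freemod A V) (y : K) :
  free_mul x (submod_val y) \in submodule_pred (ker (free_cover V)).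
Proof.
apply/eqP; rewrite free_cover_mul (eqP (submod_valP y)).
by rewrite (bilin_0r (amul_bilin m)).
Qed.

(** The kernel K is a module over all of A[V]; this action, and not only the product of
K that it restricts to, is what makes elements of K (x) N square to 0 as soon as
they vanish in A[V] (x) N. *)
Definition ideal_act (x : freemod A V) (y : K) : K := Submod (ideal_mem x y).

Fact ideal_act_bilin : bilinear_op ideal_act.
Proof.
split=> [y|x] a u v; apply: val_inj; rewrite linearP /=.
  exact: (bilin_Pl free_mul_bilin).
exact: (bilin_Pr free_mul_bilin).
Qed.

Definition ideal_mul (x y : K) : K := ideal_act (submod_val x) y.

Fact ideal_mul_bilin : bilinear_op ideal_mul.
Proof.
split=> [y|x] a u v; last exact: (bilin_Pr ideal_act_bilin).
by rewrite /ideal_mul linearP; exact: (bilin_Pl ideal_act_bilin).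
Qed.

Fact ideal_mulC : commutative ideal_mul.
Proof. by move=> x y; apply: val_inj; exact: free_mulC. Qed.

Fact ideal_mulA : associative ideal_mul.
Proof. by move=> x y z; apply: val_inj; exact: free_mulA. Qed.

Definition kernel_algebra : algebra_mul K :=
  AlgebraMul ideal_mul_bilin ideal_mulC ideal_mulA.

(** The p-th root in A[V] of an element of K lies in K: its image in V has p-th
power 0, and the Frobenius of V is injective. *)
Lemma kernel_algebra_perfect p : prime p -> perfect p A ->
  perfect_algebra p m -> perfect_algebra p kernel_algebra.
Proof.
move=> p_prime perfA perfV; have [A_p _] := perfA.
have [r rK Kr] := semigroup_algebra_perfect p_prime perfA perfV.
have val_frob (x : K) : submod_val (frob p kernel_algebra x)
    = frob p semigroup_algebra (submod_val x).
  by rewrite /frob; elim: p.-1 => //= n ->.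
have cover_frob x : free_cover V (frob p semigroup_algebra x)
    = frob p m (free_cover V x).
  by rewrite /frob; elim: p.-1 => [|k IHk] //; rewrite !iterS free_cover_mul IHk.
have r_ker (x : K) : r (submod_val x) \in submodule_pred (ker (free_cover V)).
  apply/eqP/(bij_inj perfV); rewrite -cover_frob Kr (frob0 m p_prime A_p).
  exact: (eqP (submod_valP x)).
exists (fun x => Submod (r_ker x)) => x; apply: val_inj => /=.
  by rewrite val_frob rK.
by rewrite val_frob /= Kr.
Qed.

End KernelIdeal.
End SemigroupAlgebra.

(** * Tensor products of algebras *)

Section TensorUniversal.
Variables M N : lmodType A.

Lemma tensor_ind (P : tensor M N -> Prop) :
  P 0 -> (forall x y, P x -> P y -> P (x + y)) ->
  (forall m n, P (pure_tensor m n)) -> forall x, P x.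
Proof.
move=> P0 PD Pp x; have [v ->] := quotmod_repr x.
elim/freemod_ind: v => [|u v IHu IHv|a [m n]].
- by rewrite raddf0.
- by rewrite raddfD; exact: PD.
by rewrite linearZ; have := Pp (a *: m) n; rewrite pure_tensorZl.
Qed.

Section Lift.
Variables (V : lmodType A) (h : M -> N -> V) (hb : bilinear_op h).

Fact tensor_lift_subproof (u : freemod A (M * N)%type) :
  u \in submodule_pred (Defs.span (@bilinear_relation A M N)) ->
  free_lift (fun mn : M * N => h mn.1 mn.2) u = 0.
Proof.
move=> /asboolP/(_ (ker (free_lift (fun mn : M * N => h mn.1 mn.2)))) uS.
apply/eqP/uS => {uS} w; rewrite inE => -[m m' n|m n n'|a m n|a m n]; apply/eqP.
- by rewrite linearB linearD /= !free_lift_gen /= (bilin_Dl hb) subrr.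
- by rewrite linearB linearD /= !free_lift_gen /= (bilin_Dr hb) subrr.
- by rewrite linearB linearZ /= !free_lift_gen /= (bilin_Zl hb) subrr.
- by rewrite linearB linearZ /= !free_lift_gen /= (bilin_Zr hb) subrr.
Qed.

Definition tensor_lift : {linear tensor M N -> V} :=
  quot_lift tensor_lift_subproof.

Lemma tensor_liftE m n : tensor_lift (pure_tensor m n) = h m n.
Proof. exact: etrans (quot_liftE _ _) (free_lift_gen _ _). Qed.

Lemma tensor_liftD x y :
  tensor_lift (x + y) = tensor_lift x + tensor_lift y.
Proof. exact: linearD. Qed.

End Lift.

Lemma pure_bilin : bilinear_op (@pure_tensor A M N).
Proof.
split=> [n|m] a u v; first by rewrite pure_tensorDl pure_tensorZl.
by rewrite pure_tensorDr pure_tensorZr.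
Qed.

End TensorUniversal.

(** Two bilinear maps M1 x M2 -> M3 and N1 x N2 -> N3 induce one on tensor products.
Both the product of K (x) N and the action of A[V] (x) N on it have this form. *)
Section TensorOp.
Variables (M1 M2 M3 N1 N2 N3 : lmodType A).
Variables (al : M1 -> M2 -> M3) (be : N1 -> N2 -> N3).
Hypotheses (al_bilin : bilinear_op al) (be_bilin : bilinear_op be).

Fact tensor_op_pure_bilin m2 n2 : bilinear_op
  (fun m1 n1 => pure_tensor (al m1 m2) (be n1 n2)).
Proof.
split=> [n|m] a u v.
  by rewrite (bilin_Pl al_bilin) (bilin_Pl (pure_bilin _ _)).
by rewrite (bilin_Pl be_bilin) (bilin_Pr (pure_bilin _ _)).
Qed.

Fact tensor_op_bilin_r (x : tensor M1 N1) : bilinear_op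
  (fun m2 n2 => tensor_lift (tensor_op_pure_bilin m2 n2) x).
Proof.
split=> [n2|m2] a u v; elim/tensor_ind: x => [|x y IHx IHy|m1 n1].
- by rewrite !raddf0 addr0.
- by rewrite !tensor_liftD IHx IHy scalerDr addrACA.
- by rewrite !tensor_liftE (bilin_Pr al_bilin) (bilin_Pl (pure_bilin _ _)).
- by rewrite !raddf0 addr0.
- by rewrite !tensor_liftD IHx IHy scalerDr addrACA.
- by rewrite !tensor_liftE (bilin_Pr be_bilin) (bilin_Pr (pure_bilin _ _)).
Qed.

Definition tensor_op (x : tensor M1 N1) (y : tensor M2 N2) : tensor M3 N3 :=
  tensor_lift (tensor_op_bilin_r x) y.

Lemma tensor_op_pure m1 n1 m2 n2 :
  tensor_op (pure_tensor m1 n1) (pure_tensor m2 n2)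
  = pure_tensor (al m1 m2) (be n1 n2).
Proof. by rewrite /tensor_op !tensor_liftE. Qed.

Lemma tensor_op_bilin : bilinear_op tensor_op.
Proof.
split=> [y|x] a u v; last by rewrite /tensor_op linearP.
rewrite /tensor_op; elim/tensor_ind: y => [|x y IHx IHy|m2 n2].
- by rewrite !raddf0 addr0.
- by rewrite !tensor_liftD IHx IHy scalerDr addrACA.
- by rewrite !tensor_liftE linearP.
Qed.

End TensorOp.

Section TensorAlgebra.
Variables (M N : lmodType A) (mM : algebra_mul M) (mN : algebra_mul N).

Let bil := tensor_op_bilin (amul_bilin mM) (amul_bilin mN).
Let op_pure := tensor_op_pure (amul_bilin mM) (amul_bilin mN).

Fact tensor_mulC : commutative (tensor_op (amul_bilin mM) (amul_bilin mN)).
Proof.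
move=> x y; elim/tensor_ind: x => [|x x' IHx IHx'|m n].
- by rewrite (bilin_0l bil) (bilin_0r bil).
- by rewrite (bilin_Dl bil) (bilin_Dr bil) IHx IHx'.
elim/tensor_ind: y => [|y y' IHy IHy'|m' n'].
- by rewrite (bilin_0l bil) (bilin_0r bil).
- by rewrite (bilin_Dl bil) (bilin_Dr bil) IHy IHy'.
by rewrite !op_pure amulC [mN _ _]amulC.
Qed.

Fact tensor_mulA : associative (tensor_op (amul_bilin mM) (amul_bilin mN)).
Proof.
move=> x y z; elim/tensor_ind: x => [|x x' IHx IHx'|m n].
- by rewrite !(bilin_0l bil).
- by rewrite !(bilin_Dl bil) IHx IHx'.
elim/tensor_ind: y => [|y y' IHy IHy'|m' n'].
- by rewrite (bilin_0r bil) !(bilin_0l bil) (bilin_0r bil).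
- by rewrite (bilin_Dr bil) !(bilin_Dl bil) (bilin_Dr bil) IHy IHy'.
elim/tensor_ind: z => [|z z' IHz IHz'|m'' n''].
- by rewrite !(bilin_0r bil).
- by rewrite !(bilin_Dr bil) IHz IHz'.
by rewrite !op_pure !amulA.
Qed.

Definition tensor_algebra : algebra_mul (tensor M N) :=
  AlgebraMul bil tensor_mulC tensor_mulA.

Lemma frob_pure p m n : frob p tensor_algebra (pure_tensor m n)
  = pure_tensor (frob p mM m) (frob p mN n).
Proof. by rewrite /frob; elim: p.-1 => //= k ->; rewrite op_pure. Qed.

End TensorAlgebra.

(** Restriction of scalars along an endomorphism of A: p-th roots are only
semilinear, and become linear with values in a twisted module. *)
Section Twist.
Variables (theta : {rmorphism A -> A}) (V : lmodType A).

Definition twist of {rmorphism A -> A} : Type := V.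
Local Notation tV := (twist theta).

HB.instance Definition _ := GRing.Zmodule.on tV.

Definition twist_scale (a : A) (v : tV) : tV := theta a *: (v : V).

Fact twist_scaleA a b v : twist_scale a (twist_scale b v) = twist_scale (a * b) v.
Proof. by rewrite /twist_scale scalerA rmorphM. Qed.

Fact twist_scale1 : left_id 1 twist_scale.
Proof. by move=> v; rewrite /twist_scale rmorph1 scale1r. Qed.

Fact twist_scaleDr : right_distributive twist_scale +%R.
Proof. by move=> a u v; rewrite /twist_scale scalerDr. Qed.

Fact twist_scaleDl v : {morph twist_scale^~ v : a b / a + b}.
Proof. by move=> a b; rewrite /twist_scale rmorphD scalerDl. Qed.

HB.instance Definition _ := GRing.Zmodule_isLmodule.Build A tV
  twist_scaleA twist_scale1 twist_scaleDr twist_scaleDl.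

End Twist.

Section PerfectTensor.
Variable p : nat.
Hypotheses (p_prime : prime p) (perfA : perfect p A).

Lemma perfect_root : exists theta : {rmorphism A -> A}, forall a, theta a ^+ p = a.
Proof.
have [A_p [r rK Kr]] := perfA.
have injA : injective (fun a : A => a ^+ p) := can_inj rK.
have rB : zmod_morphism r.
  move=> a b; apply: (injA); rewrite Kr; apply: (addIr b); rewrite subrK.
  by rewrite -[X in _ = _ + X]Kr -expr_primeD // subrK Kr.
have rM : monoid_morphism r.
  split=> [|a b]; apply: (injA); rewrite Kr ?expr1n //.
  by rewrite exprMn !Kr.
pose rB' := GRing.isZmodMorphism.Build A A r rB.
pose rM' := GRing.isMonoidMorphism.Build A A r rM.
pose theta : {rmorphism A -> A} := HB.pack r rB' rM'.
by exists theta.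
Qed.

Section Root.
Variables (V : lmodType A) (m : algebra_mul V) (r : V -> V).
Variable theta : {rmorphism A -> A}.
Hypotheses (thetaK : forall a, theta a ^+ p = a).
Hypotheses (rK : cancel (frob p m) r) (Kr : cancel r (frob p m)).

Lemma root_semilinear a x y : r (a *: x + y) = theta a *: r x + r y.
Proof.
have [A_p _] := perfA; apply: (can_inj rK).
by rewrite Kr frobD // frobZ // thetaK !Kr.
Qed.

End Root.

(** The map m (x) n |-> m^(1/p) (x) n^(1/p) is well defined, because both roots are
semilinear for the root of A, and additive; it inverts the Frobenius on pure
tensors. *)
Lemma tensor_frob_inj (M N : lmodType A) (mM : algebra_mul M) (mN : algebra_mul N) :
  perfect_algebra p mM -> perfect_algebra p mN ->
  injective (frob p (tensor_algebra mM mN)).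
Proof.
move=> [rM rMK KrM] [rN rNK KrN]; have [A_p _] := perfA.
have [theta thetaK] := perfect_root.
have rM_semi := root_semilinear thetaK rMK KrM.
have rN_semi := root_semilinear thetaK rNK KrN.
pose h (m : M) (n : N) : twist (tensor M N) theta := pure_tensor (rM m) (rN n).
have h_bilin : bilinear_op h.
  split=> [n|m] a u v; rewrite /h.
    by rewrite rM_semi (bilin_Pl (pure_bilin _ _)).
  by rewrite rN_semi (bilin_Pr (pure_bilin _ _)).
have frobTD := frobD (tensor_algebra mM mN) p_prime A_p.
apply: (@can_inj _ _ _ (tensor_lift h_bilin : _ -> tensor M N)).
elim/tensor_ind => [|x y IHx IHy|m n].
- by rewrite frob0 // raddf0.
- by rewrite frobTD raddfD [X in X + _]IHx [X in _ + X]IHy.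
by rewrite frob_pure tensor_liftE /h rMK rNK.
Qed.

End PerfectTensor.

(** The kernel in question is Tor_1(V, N).  Multiplication in K (x) N factors through the
image of the left factor in A[V] (x) N, so this kernel squares to 0, and an
injective Frobenius leaves no room for it. *)
Lemma tensor_kernel_inj (p : nat) (V N : lmodType A) (m : algebra_mul V)
    (mN : algebra_mul N) (x : tensor (submod (ker (free_cover V))) N) :
  prime p -> perfect p A -> perfect_algebra p m -> perfect_algebra p mN ->
  tensor_map N (@submod_val _ _ (ker (free_cover V))) x = 0 -> x = 0.
Proof.
move=> p_prime perfA perfV perfN x0; have [A_p _] := perfA.
have perfK := kernel_algebra_perfect p_prime perfA perfV.
apply: (tensor_frob_inj p_prime perfA perfK perfN).
rewrite frob0 //; apply: frob_sqr0 => //.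
pose act := tensor_op (ideal_act_bilin m) (amul_bilin mN).
have act_bilin : bilinear_op act := tensor_op_bilin _ _.
set mT := tensor_algebra _ _; have mT_bilin := amul_bilin mT.
have mulE u y : mT u y = act (tensor_map N (@submod_val _ _ (ker (free_cover V))) u) y.
  elim/tensor_ind: u => [|u v IHu IHv|k n].
  - by rewrite raddf0 (bilin_0l mT_bilin) (bilin_0l act_bilin).
  - by rewrite raddfD (bilin_Dl mT_bilin) (bilin_Dl act_bilin) IHu IHv.
  rewrite tensor_mapE; elim/tensor_ind: y => [|u v IHu IHv|k' n'].
  - by rewrite (bilin_0r mT_bilin) (bilin_0r act_bilin).
  - by rewrite (bilin_Dr mT_bilin) (bilin_Dr act_bilin) IHu IHv.
  rewrite [RHS]tensor_op_pure.
  exact: (tensor_op_pure (amul_bilin (kernel_algebra m)) (amul_bilin mN)).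
by rewrite mulE x0 (bilin_0l act_bilin).
Qed.

(** * Right exactness and the vanishing of Tor *)

Section RightExact.
Variables (U V N : lmodType A) (q : {linear U -> V}).
Hypothesis q_surj : forall v, exists u, q u = v.

Lemma tensor_map_surj y : exists x, tensor_map N q x = y.
Proof.
elim/tensor_ind: y => [|_ _ [x <-] [y <-]|v n].
- by exists 0; rewrite raddf0.
- by exists (x + y); rewrite raddfD.
by have [u <-] := q_surj v; exists (pure_tensor u n); rewrite tensor_mapE.
Qed.

(** The map v (x) n |-> [u (x) n], for any u above v, is well defined modulo the image of
ker q (x) N, and is a left inverse of the map induced by q on that quotient. *)
Lemma tensor_map_exact x : tensor_map N q x = 0 ->
  exists y, tensor_map N (@submod_val _ _ (ker q)) y = x.
Proof.
have [r rK] := choice q_surj.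
pose I := im (tensor_map N (@submod_val _ _ (ker q))).
have kerI u n : q u = 0 -> pure_tensor u n \in submodule_pred I.
  move=> /eqP u0; apply/asboolP; exists (pure_tensor (@Submod _ _ (ker q) u u0) n).
  by rewrite tensor_mapE.
pose h (v : V) (n : N) : quotmod I := quotmod_pi I (pure_tensor (r v) n).
have h_bilin : bilinear_op h.
  split=> [n|v] a u w; rewrite /h -linearP.
    apply/quotmod_eqP; rewrite -(bilin_Pl (pure_bilin _ _)).
    rewrite -scaleN1r addrC -(bilin_Pl (pure_bilin _ _)).
    by apply: kerI; rewrite linearP [q (_ *: _ + _)]linearP /= !rK scaleN1r addNr.
  by rewrite (bilin_Pr (pure_bilin _ _)).
have hK y : tensor_lift h_bilin (tensor_map N q y) = quotmod_pi I y.
  elim/tensor_ind: y => [|y z IHy IHz|u n]; first by rewrite !raddf0.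
    by rewrite linearD tensor_liftD IHy IHz -linearD.
  rewrite tensor_mapE tensor_liftE; apply/quotmod_eqP.
  rewrite -scaleN1r addrC -(bilin_Pl (pure_bilin _ _)); apply: kerI.
  by rewrite linearP /= rK scaleN1r addNr.
move=> x0; have := hK x; rewrite x0 raddf0 -(raddf0 (quotmod_pi I)) => /esym.
by move=> /quotmod_eqP; rewrite subr0 => /asboolP.
Qed.

End RightExact.

End PerfectAlgebras.

Section RestrictedAlgebra.
Variables (A B : comPzRingType) (f : {rmorphism A -> B}).

Let mulB (x y : restrict_scalars f) : restrict_scalars f := (x : B) * (y : B).

Fact restrict_mul_bilin : bilinear_op mulB.
Proof.
split=> [y|x] a u v; rewrite /mulB.
  by rewrite [LHS]mulrDl -mulrA.
by rewrite [LHS]mulrDr mulrCA.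
Qed.

Definition restrict_algebra : algebra_mul (restrict_scalars f) :=
  AlgebraMul restrict_mul_bilin (@mulrC B) (@mulrA B).

Lemma restrict_algebra_perfect p :
  prime p -> perfect p B -> perfect_algebra p restrict_algebra.
Proof.
move=> p_prime [_ bijB]; apply: (eq_bij bijB) => x.
rewrite /frob -[in LHS](prednK (prime_gt0 p_prime)).
by elim: p.-1 => [|n IHn] /=; rewrite ?expr1 // exprS IHn.
Qed.

End RestrictedAlgebra.

Lemma syzygy_perfect (p : nat) (A : comPzRingType) (M : lmodType A)
    (m : algebra_mul M) :
  prime p -> perfect p A -> perfect_algebra p m ->
  forall n, exists mn : algebra_mul (syzygy M n), perfect_algebra p mn.
Proof.
move=> p_prime perfA perfM; elim=> [|n [mn perfn]]; first by exists m.
by exists (kernel_algebra mn); exact: kernel_algebra_perfect.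
Qed.

Lemma tensor_map_comp (A : comPzRingType) (U V W N : lmodType A)
    (h : {linear U -> V}) (k : {linear V -> W}) (x : tensor U N) :
  tensor_map N (k \o h) x = tensor_map N k (tensor_map N h x).
Proof.
elim/tensor_ind: x => [|x y IHx IHy|u n]; first by rewrite !raddf0.
  by rewrite !linearD IHx IHy.
by rewrite !tensor_mapE.
Qed.

(** As j stays injective after tensoring, a cycle already dies in V (x) N; right
exactness then lifts it to (ker c1) (x) N, which c2 covers. *)
Lemma tensor_exact (A : comPzRingType) (N F2 F1 V F0 : lmodType A)
    (c1 : {linear F1 -> V}) (c2 : {linear F2 -> submod (ker c1)})
    (j : {linear V -> F0}) (z : tensor F1 N) :
  (forall v, exists u, c1 u = v) -> (forall v, exists u, c2 u = v) ->
  (forall x, tensor_map N j x = 0 -> x = 0) ->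
  tensor_map N (j \o c1) z = 0 ->
  exists y, tensor_map N (@submod_val _ _ (ker c1) \o c2) y = z.
Proof.
move=> c1_surj c2_surj j_inj; rewrite tensor_map_comp => /j_inj.
move=> /(tensor_map_exact c1_surj)[w <-].
have [y <-] := tensor_map_surj c2_surj w.
by exists y; rewrite tensor_map_comp.
Qed.

(** Dimension shifting: Tor_(n+1)(M, N) is Tor_1 of the n-th syzygy, the kernel that the
hypothesis makes trivial. *)
Lemma Tor_eq0 (A : comPzRingType) (M N : lmodType A) (n : nat) :
  (forall x, tensor_map N (@submod_val _ _ (ker (free_cover (syzygy M n)))) x = 0 ->
    x = 0) ->
  forall x : Tor M N n.+1, x = 0.
Proof.
move=> syz_inj x; have [[z z_cycle] ->] := quotmod_repr x.
rewrite -(raddf0 (quotmod_pi _)); apply/quotmod_eqP; rewrite subr0.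
apply/asboolP.
apply: tensor_exact (@free_cover_surj _ _) (@free_cover_surj _ _) syz_inj _.
exact: (eqP z_cycle).
Qed.

Theorem lemma3p16 (p : nat) (A B C : comPzRingType)
    (f : {rmorphism A -> B}) (g : {rmorphism A -> C})
    (p_prime : prime p)
    (perfA : perfect p A) (perfB : perfect p B) (perfC : perfect p C)
    (i : nat) (i_gt0 : (0 < i)%N) :
  forall x : Tor (restrict_scalars f) (restrict_scalars g) i, x = 0%R.
Proof.
case: i i_gt0 => // n _; apply: Tor_eq0 => x.
have perfB' := restrict_algebra_perfect f p_prime perfB.
have perfC' := restrict_algebra_perfect g p_prime perfC.
have [m perfm] := syzygy_perfect p_prime perfA perfB' n.
exact: (tensor_kernel_inj p_prime perfA perfm perfC').
Qed.
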